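(* Let $d\in\mathbb{N}$. The ring $\mathcal{S}'(\mathbb{Z}^d)$ is a coherent ring.
   Context: $\mathbb{N}=\{1,2,3,\dots\}$. For $\mathbf{n}=(n_1,\dots,n_d)\in\mathbb{Z}^d$ write $|\mathbf{n}|_1:=|n_1|+\cdots+|n_d|$. The set $\mathcal{S}'(\mathbb{Z}^d)$ consists of all maps $\mathbf{a}:\mathbb{Z}^d\to\mathbb{C}$ of at most polynomial growth, i.e. such that there exist a real $M>0$ and $k\in\mathbb{N}$ with $|\mathbf{a}(\mathbf{n})|\le M(1+|\mathbf{n}|_1)^k$ for all $\mathbf{n}\in\mathbb{Z}^d$. With pointwise addition and multiplication it is a commutative unital ring. A commutative unital ring $R$ is called coherent if every finitely generated ideal $I$ of $R$ is finitely presentable, that is, there exists an exact sequence of $R$-modules $0\to K\to F\to I\to 0$, where $F$ is a finitely generated free $R$-module and $K$ is a finitely generated $R$-module. *)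

(* Defs.v *)
From HB Require Import structures.
From mathcomp Require Import all_boot all_order all_algebra.
From mathcomp Require Import complex.
From mathcomp Require Import boolp classical_sets functions reals.

Set Implicit Arguments.
Unset Strict Implicit.
Unset Printing Implicit Defensive.

Import Order.TTheory GRing.Theory Num.Theory.

Local Open Scope ring_scope.
Local Open Scope complex_scope.

Definition fin_gen (R : comPzRingType) (M : lmodType R) : Prop :=
  exists (n : nat) (g : 'I_n -> M),
    forall x : M, exists c : 'I_n -> R, x = \sum_(i < n) c i *: g i.

Definition fin_gen_free (R : comPzRingType) (M : lmodType R) : Prop :=
  exists (n : nat) (b : 'I_n -> M),
    forall x : M, exists! c : {ffun 'I_n -> R}, x = \sum_(i < n) c i *: b i.

Definition short_exact (R : comPzRingType) (K F M : lmodType R)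
    (i : {linear K -> F}) (p : {linear F -> M}) : Prop :=
  [/\ injective i,
      forall x : F, p x = 0 <-> exists y : K, i y = x
    & forall z : M, exists x : F, p x = z].

Definition fin_presentable (R : comPzRingType) (M : lmodType R) : Prop :=
  exists (K F : lmodType R) (i : {linear K -> F}) (p : {linear F -> M}),
    [/\ fin_gen_free F, fin_gen K & short_exact i p].

(* Ideals of R are the submodules of the regular module R^o; the library's    *)
(* [idealr] is not used because it only covers proper ideals.                 *)
Definition ideal_module (R : comPzRingType) (I : submodClosed R^o) : Type :=
  {x : R^o | x \in I}.

Section IdealModule.
Variables (R : comPzRingType) (I : submodClosed R^o).

HB.instance Definition _ := SubChoice.on (ideal_module I).
HB.instance Definition _ := [SubChoice_isSubLmodule of ideal_module I by <:].

End IdealModule.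

Definition coherent (R : comPzRingType) : Prop :=
  forall I : submodClosed R^o,
    fin_gen (ideal_module I) -> fin_presentable (ideal_module I).

Definition norm1 (d : nat) (n : 'rV[int]_d) : nat :=
  (\sum_(i < d) `|n 0%R i|)%N.

Definition poly_growth (R : realType) (d : nat) (a : 'rV[int]_d -> R[i]) :
    Prop :=
  exists (M : R) (k : nat),
    [/\ 0 < M, (0 < k)%N
      & forall n, `|a n| <= (M * (1 + (norm1 n)%:R) ^+ k)%:C].

Definition tempered_pred (R : realType) (d : nat) :
    {pred 'rV[int]_d -> R[i]} := fun a => `[< poly_growth a >].
Arguments tempered_pred : clear implicits.

Definition tempered (R : realType) (d : nat) : Type :=
  {a : 'rV[int]_d -> R[i] | a \in tempered_pred R d}.

Section TemperedRing.
Variables (R : realType) (d : nat).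

Let base_ge1 (n : 'rV[int]_d) : 1 <= 1 + (norm1 n)%:R :> R.
Proof. by rewrite lerDl. Qed.

Let base_ge0 (n : 'rV[int]_d) : 0 <= 1 + (norm1 n)%:R :> R.
Proof. exact: le_trans (base_ge1 n). Qed.

Lemma tempered_subring_closed : subring_closed (tempered_pred R d).
Proof.
split=> [|a b /asboolP[M [k [M0 k0 Ma]]] /asboolP[N [l [N0 l0 Nb]]]
        |a b /asboolP[M [k [M0 k0 Ma]]] /asboolP[N [l [N0 l0 Nb]]]];
  apply/asboolP.
- exists 1, 1%N; split=> // n.
  by rewrite normr1 mul1r expr1 -(rmorph1 (real_complex R)) lecR.
- exists (M + N), (k + l)%N; split=> [||n]; first exact: addr_gt0.
    by rewrite addn_gt0 k0.
  apply: le_trans (ler_normB _ _) _; apply: le_trans (lerD (Ma n) (Nb n)) _.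
  rewrite -rmorphD lecR mulrDl lerD //.
    by rewrite ler_pM2l // ler_weXn2l // leq_addr.
  by rewrite ler_pM2l // ler_weXn2l // leq_addl.
- exists (M * N), (k + l)%N; split=> [||n]; first exact: mulr_gt0.
    by rewrite addn_gt0 k0.
  rewrite exprD mulrACA rmorphM /= normrM.
  by apply: ler_pM.
Qed.

HB.instance Definition _ :=
  GRing.isSubringClosed.Build _ (tempered_pred R d) tempered_subring_closed.
HB.instance Definition _ := SubChoice.on (tempered R d).
HB.instance Definition _ :=
  GRing.SubChoice_isSubComPzRing.Build _ _ (tempered R d)
    tempered_subring_closed.

End TemperedRing.

(* Main.v *)
Require Import Defs.
From mathcomp Require Import all_boot all_order all_algebra.
From mathcomp Require Import reals.
From HB Require Import structures.
From mathcomp Require Import complex boolp functions ring.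

(** At each point [n], the kernel of the functional [c |-> \sum_i c i * f i n]
is the image of the orthogonal projection onto the hyperplane orthogonal to the
conjugate of [f n]. The entries of orthogonal projections are bounded,
uniformly in [n], hence they are tempered no matter how small the values of
[f] are: the syzygies of [f] are generated by the rows of this matrix. *)

Set Implicit Arguments.
Unset Strict Implicit.
Unset Printing Implicit Defensive.

Import Order.TTheory GRing.Theory Num.Theory.

Local Open Scope ring_scope.
Local Open Scope complex_scope.

Section Kernel.
Variables (A : comPzRingType) (U V : lmodType A) (p : {linear U -> V}).

Definition ker_pred : {pred U} := fun x => p x == 0.

Lemma ker_pred_submod_closed : submod_closed ker_pred.
Proof.
split=> [|a x y]; rewrite !unfold_in ?linear0 //.
by move=> /eqP px /eqP py; rewrite linearP px py scaler0 addr0.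
Qed.

HB.instance Definition _ :=
  GRing.isSubmodClosed.Build _ _ ker_pred ker_pred_submod_closed.

Definition ker_module : Type := {x : U | x \in ker_pred}.

HB.instance Definition _ := SubChoice.on ker_module.
HB.instance Definition _ := [SubChoice_isSubLmodule of ker_module by <:].

Lemma ker_short_exact : (forall z, exists x, p x = z) ->
  short_exact (\val : {linear ker_module -> U}) p.
Proof.
move=> p_surj; split=> [|x|//]; first exact: val_inj.
split=> [px0|[y <-]]; last exact/eqP/(valP y).
have kx : x \in ker_pred by rewrite unfold_in px0.
by exists (exist _ x kx).
Qed.

End Kernel.

Section LinearCombination.
Variables (A : comPzRingType) (M : lmodType A) (n : nat) (g : 'I_n -> M).

Definition lin_comb (c : {ffun 'I_n -> A^o}) : M := \sum_(i < n) c i *: g i.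

Lemma lin_comb_is_linear : linear lin_comb.
Proof.
move=> a c e; rewrite /lin_comb scaler_sumr -big_split /=.
by apply: eq_bigr => i _; rewrite !ffunE scalerDl scalerA.
Qed.

HB.instance Definition _ :=
  GRing.isLinear.Build A {ffun 'I_n -> A^o} M _ lin_comb lin_comb_is_linear.

End LinearCombination.

Lemma ffun_fin_gen_free (A : comPzRingType) (n : nat) :
  fin_gen_free {ffun 'I_n -> A^o}.
Proof.
pose b i : {ffun 'I_n -> A^o} := [ffun j => (j == i)%:R].
(* Coordinates are read off by evaluation, which settles both existence and uniqueness of the
   coefficients. *)
have bE (c : 'I_n -> A) j : (\sum_i c i *: b i) j = c j.
  rewrite sum_ffunE (bigD1 j) //= !ffunE eqxx big1 ?addr0; first exact: mulr1.
  by move=> i ij; rewrite !ffunE eq_sym (negPf ij); exact: mulr0.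
exists n, b => x; exists x; split=> [|c xE]; apply/ffunP => j.
  by rewrite bE.
by rewrite xE bE.
Qed.

(** Generators [g] of [I] define a surjection from a free module onto [I]. Its kernel is the module
    of syzygies of [g], so generators of the syzygies yield the required presentation. *)
Lemma coherent_fin_gen_syzygies (A : comPzRingType) :
  (forall n (f : 'I_n -> A), exists m (s : 'I_m -> 'I_n -> A),
    (forall k, \sum_i s k i * f i = 0) /\
    (forall c : 'I_n -> A, \sum_i c i * f i = 0 ->
      exists e : 'I_m -> A, forall i, c i = \sum_k e k * s k i)) ->
  coherent A.
Proof.
move=> syz I [n [g g_gen]].
have [m [s [s_syz s_gen]]] := syz n (fun i => val (g i)).
pose F : lmodType A := {ffun 'I_n -> A^o}.
pose p : {linear F -> ideal_module I} := lin_comb g.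
have valp (c : F) : val (p c) = \sum_i c i * val (g i).
  by rewrite -[p c]/(lin_comb g c) raddf_sum.
exists (ker_module p), F, \val, p; split; first exact: ffun_fin_gen_free.
  have s_ker k : [ffun i => s k i] \in ker_pred p.
    apply/eqP/val_inj; rewrite valp linear0 -[RHS](s_syz k).
    by apply: eq_bigr => i _; rewrite ffunE.
  pose t k : ker_module p := exist _ [ffun i => s k i] (s_ker k).
  exists m, t => x.
  have [|e eE] := s_gen (val x).
    by rewrite -valp (eqP (valP x)) linear0.
  exists e; apply/val_inj/ffunP => i; rewrite eE raddf_sum sum_ffunE.
  by apply: eq_bigr => k _; rewrite !ffunE.
apply: ker_short_exact => z; have [c ->] := g_gen z.
exists [ffun i => c i]; rewrite /= /lin_comb.
by apply: eq_bigr => i _; rewrite ffunE.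
Qed.

Section HyperplaneProjection.
Variables (R : rcfType) (n : nat) (v : 'I_n -> R[i]).

Let sqn : R[i] := \sum_i `|v i| ^+ 2.

(* For [v = 0] this is the identity, since then [sqn^-1 = 0]. *)
Definition hyperplane_proj (k i : 'I_n) : R[i] :=
  (i == k)%:R - v k * (v i)^* / sqn.

Let sqn_ge0 : 0 <= sqn.
Proof. by apply: sumr_ge0 => i _; rewrite exprn_ge0. Qed.

Let sqr_le_sqn i : `|v i| ^+ 2 <= sqn.
Proof.
by rewrite /sqn (bigD1 i) //= lerDl sumr_ge0 // => j _; rewrite exprn_ge0.
Qed.

(** The identity part contributes [v k], and the rank-one part contributes the same amount because
    the products of [v i] with its conjugate add up to [sqn]. *)
Lemma hyperplane_proj_orthogonal k : \sum_i hyperplane_proj k i * v i = 0.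
Proof.
under eq_bigr do rewrite mulrBl.
rewrite sumrB (bigD1 k) //= eqxx mul1r big1 ?addr0; last first.
  by move=> i /negPf->; rewrite mul0r.
(* When [sqn] vanishes, nothing cancels; instead every [|v i| ^+ 2] is squeezed to 0. *)
have [sqn0|sqn_neq0] := eqVneq sqn 0.
  have vk0 : v k = 0.
    have := sqr_le_sqn k; rewrite sqn0 => vk_le0.
    by apply/eqP; rewrite -normr_eq0 -sqrf_eq0 eq_le vk_le0 exprn_ge0.
  by rewrite vk0 big1 ?subr0 // => i _; rewrite !mul0r.
apply/eqP; rewrite subr_eq0; apply/eqP.
transitivity (v k / sqn * sqn); first by rewrite divfK.
(* Only the factor [sqn] is expanded; the one in the denominator stays, so the sums agree term by
   term. *)
rewrite {2}/sqn mulr_sumr; apply: eq_bigr => i _.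
by rewrite normCK; ring.
Qed.

(** The rank-one part has [\sum_k c k * v k] as a factor, so only the identity part acts on [c].
    This covers [v = 0] as well. *)
Lemma hyperplane_proj_id (c : 'I_n -> R[i]) i :
  \sum_k c k * v k = 0 -> c i = \sum_k c k * hyperplane_proj k i.
Proof.
move=> cv0; under eq_bigr do rewrite mulrBr.
rewrite sumrB (bigD1 i) //= eqxx mulr1 big1 ?addr0; last first.
  by move=> k /negPf ki; rewrite eq_sym ki mulr0.
under eq_bigr do rewrite !mulrA.
by rewrite -!mulr_suml cv0 !mul0r subr0.
Qed.

(** Each part of the entry has norm at most 1: both [|v k|] and [|v i|] are bounded by the square
    root of [sqn], so their product is at most [sqn]. *)
Lemma hyperplane_proj_le2 k i : `|hyperplane_proj k i| <= 2.
Proof.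
apply: le_trans (ler_normB _ _) _; rewrite -[2]/(1 + 1) lerD //.
  by case: eqP => _; rewrite ?normr1 ?normr0.
have [->|sqn_neq0] := eqVneq sqn 0; first by rewrite invr0 mulr0 normr0.
have sqn_gt0 : 0 < sqn by rewrite lt0r sqn_neq0.
rewrite !normrM normfV (ger0_norm sqn_ge0) ler_pdivrMr // mul1r norm_conjC.
have le_sqrt j : `|v j| <= sqrtC sqn.
  by rewrite -(@ler_pXn2r _ 2) ?nnegrE ?sqrtC_ge0 // sqrtCK.
by rewrite -[leRHS]sqrtCK expr2 ler_pM.
Qed.

End HyperplaneProjection.

Lemma bounded_tempered (R : realType) (d : nat) (B : R)
    (a : 'rV[int]_d -> R[i]) :
  0 < B -> (forall n, `|a n| <= B%:C) -> a \in tempered_pred R d.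
Proof.
(* The exponent 1 is the least that polynomial growth allows; it does no harm as the base is at
   least 1. *)
move=> B0 aB; apply/asboolP; exists B, 1%N; split=> // n.
by apply: le_trans (aB n) _; rewrite lecR expr1 ler_peMr ?lerDl // ltW.
Qed.

(** Evaluation at [x] turns relations over the ring into linear algebra over [R[i]]. *)
Lemma tempered_sumE (R : realType) (d m : nat) (F G : 'I_m -> tempered R d) x :
  val (\sum_i F i * G i) x = \sum_i val (F i) x * val (G i) x.
Proof. by rewrite raddf_sum fct_sumE; apply: eq_bigr. Qed.

Theorem theorem4p1 (R : realType) (d : nat) (hd : (0 < d)%N) :
  coherent (tempered R d).
Proof.
apply: coherent_fin_gen_syzygies => m f.
pose v x i := val (f i) x.
have P_tempered k i :
    (fun x => hyperplane_proj (v x) k i) \in tempered_pred R d.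
  apply: (@bounded_tempered _ _ 2) => // x.
  by rewrite rmorph_nat hyperplane_proj_le2.
pose P k i : tempered R d :=
  exist _ (fun x => hyperplane_proj (v x) k i) (P_tempered k i).
exists m, P; split=> [k|c cf0].
  apply/val_inj/funext => x; rewrite tempered_sumE.
  exact: hyperplane_proj_orthogonal.
(* A syzygy is fixed by the projection, so it serves as its own family of coefficients; it is
   tempered by its type. *)
exists c => i; apply/val_inj/funext => x; rewrite tempered_sumE.
apply: hyperplane_proj_id.
by rewrite -tempered_sumE cf0.
Qed.
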